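(* Every nested matroid is laminar.
   Context: All matroids are finite. A transversal presentation of a matroid $N$ on $E$ is a finite sequence $(B_1,\dots,B_n)$ of subsets of $E$ such that the independent sets of $N$ are exactly the partial transversals of $(B_1,\dots,B_n)$. A transversal matroid is nested if it has a transversal presentation $(B_1,B_2,\dots,B_n)$ with $B_1\subseteq B_2\subseteq\dots\subseteq B_n$. A family $\mathcal{A}$ of subsets of a finite set $E$ is laminar if, for all $A,B\in\mathcal{A}$ with $A\cap B\neq\emptyset$, either $A\subseteq B$ or $B\subseteq A$. Given a laminar family $\mathcal{A}$ of subsets of $E$ and a capacity function $c:\mathcal{A}\to\mathbb{Z}_{\ge 0}$, $M(E,\mathcal{A},c)$ is the matroid on $E$ whose independent sets are exactly the sets $I\subseteq E$ with $|I\cap A|\le c(A)$ for all $A\in\mathcal{A}$. A matroid is laminar if it is isomorphic to $M(E,\mathcal{A},c)$ for some finite set $E$, laminar family $\mathcal{A}$ of subsets of $E$, and capacity function $c$. *)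

(* Defs.v *)
From mathcomp Require Import all_boot.
Set Implicit Arguments.
Unset Strict Implicit.
Unset Printing Implicit Defensive.

(* The ground set of a matroid is the whole finite type E. *)
Record matroid (E : finType) := Matroid {
  indep : {set {set E}};
  indep0 : set0 \in indep;
  indepS : forall I J : {set E}, I \subset J -> J \in indep -> I \in indep;
  indep_aug : forall I J : {set E},
    I \in indep -> J \in indep -> #|I| < #|J| ->
    exists2 x, x \in J :\: I & x |: I \in indep }.

Definition matroid_iso (E F : finType) (M : matroid E) (N : matroid F) : Prop :=
  exists2 f : E -> F, bijective f &
    forall I : {set E}, (I \in indep M) = (f @: I \in indep N).

Definition is_transversal (E J : finType) (B : J -> {set E}) (X : {set E}) :
    Prop :=
  exists e : J -> E,
    [/\ injective e, forall j, e j \in B j & X = [set e j | j in J]].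

Definition is_partial_transversal (E J : finType) (B : J -> {set E})
    (X : {set E}) : Prop :=
  exists K : {set J}, is_transversal (fun k : {j : J | j \in K} => B (val k)) X.

Definition transversal_presentation (E : finType) (N : matroid E) (n : nat)
    (B : 'I_n -> {set E}) : Prop :=
  forall X : {set E}, X \in indep N <-> is_partial_transversal B X.

(* Having any such presentation already makes N a transversal matroid, so that
   is not required separately. *)
Definition nested_matroid (E : finType) (N : matroid E) : Prop :=
  exists (n : nat) (B : 'I_n -> {set E}),
    transversal_presentation N B /\
    (forall i j : 'I_n, i <= j -> B i \subset B j).

Definition laminar_family (E : finType) (A : {set {set E}}) : Prop :=
  forall X Y : {set E}, X \in A -> Y \in A -> X :&: Y != set0 ->
    X \subset Y \/ Y \subset X.

(* The capacity function is total; only its values on members of A matter. *)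
Definition laminar_indep (E : finType) (A : {set {set E}}) (c : {set E} -> nat) :
    {set {set E}} :=
  [set I : {set E} | [forall X in A, #|I :&: X| <= c X]].

Section LaminarMatroid.
Variables (E : finType) (A : {set {set E}}) (c : {set E} -> nat).
Hypothesis lamA : laminar_family A.

Lemma laminar_indepP (I : {set E}) :
  reflect (forall X, X \in A -> #|I :&: X| <= c X) (I \in laminar_indep A c).
Proof. by rewrite inE; apply: forall_inP. Qed.

Lemma laminar_indep0 : set0 \in laminar_indep A c.
Proof. by apply/laminar_indepP => X _; rewrite set0I cards0. Qed.

Lemma laminar_indepS (I J : {set E}) :
  I \subset J -> J \in laminar_indep A c -> I \in laminar_indep A c.
Proof.
move=> sIJ /laminar_indepP iJ; apply/laminar_indepP => X AX.
by apply: leq_trans (iJ X AX); apply/subset_leq_card/setSI.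
Qed.

Lemma laminar_indep_aug (I J : {set E}) :
  I \in laminar_indep A c -> J \in laminar_indep A c -> #|I| < #|J| ->
  exists2 x, x \in J :\: I & x |: I \in laminar_indep A c.
Proof.
move=> /laminar_indepP iI /laminar_indepP iJ ltIJ.
case: (boolP [exists x in J :\: I, x |: I \in laminar_indep A c]).
  by case/exists_inP=> x; exists x.
rewrite negb_exists_in => /forall_inP noaug; exfalso.
pose tight := [set X in A | #|I :&: X| == c X].
pose P := [set X in tight | [forall Y in tight, ~~ (X \proper Y)]].
have PA X : X \in P -> X \in A by rewrite !inE => /andP[/andP[]].
have Pc X : X \in P -> #|I :&: X| = c X.
  by rewrite !inE => /andP[/andP[_ /eqP]].
have Pmax X Y : X \in P -> Y \in P -> X \subset Y -> X = Y.
  rewrite !inE => /andP[_ /forall_inP mX] /andP[tY _] sXY.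
  have /mX : Y \in tight by rewrite inE.
  by rewrite properEneq sXY andbT negbK => /eqP.
have tP : trivIset P.
  apply/trivIsetP => X Y PX PY neXY; rewrite -setI_eq0.
  apply: contraNT neXY => neI; apply/eqP.
  case: (lamA (PA _ PX) (PA _ PY) neI) => sXY; first exact: Pmax.
  by apply/esym/Pmax.
have covJ : J :\: I \subset cover P.
  apply/subsetP => x Jx; have := noaug x Jx.
  rewrite inE negb_forall_in => /exists_inP[X AX]; rewrite -ltnNge => ltc.
  have Xx : x \in X.
    apply: contraLR ltc => nXx; rewrite -leqNgt.
    suff -> : (x |: I) :&: X = I :&: X by exact: iI.
    apply/setP => y; rewrite !inE; case: (y =P x) => // ->.
    by rewrite (negbTE nXx) !andbF.
  have tX : X \in tight.
    rewrite inE AX eqn_leq iI //= -ltnS; apply: leq_trans ltc _.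
    rewrite setIUl; apply: leq_trans (leq_card_setU _ _) _.
    rewrite -add1n leq_add2r -(cards1 x).
    exact/subset_leq_card/subsetIl.
  have txX : (X \in tight) && (x \in X) by rewrite tX.
  case: (arg_maxnP (P := fun Y : {set E} => (Y \in tight) && (x \in Y))
           (fun Y : {set E} => #|Y|) txX) => Y /andP[tY Yx] mY.
  apply/bigcupP; exists Y => //; rewrite inE tY /=.
  apply/forall_inP => Z tZ; apply/negP => pYZ.
  have /mY : (Z \in tight) && (x \in Z).
    by rewrite tZ (subsetP (proper_sub pYZ)).
  by move/(leq_trans (proper_card pYZ)); rewrite ltnn.
have cardI K : #|K :&: cover P| = \sum_(X in P) #|K :&: X|.
  pose g (x : E) : nat := x \in K.
  have gE (D : {set E}) : #|K :&: D| = \sum_(x in D) g x.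
    rewrite -sum1_card [RHS](eq_bigr (fun x => if x \in K then 1 else 0)).
      by rewrite -big_mkcondr; apply: eq_bigl => x; rewrite inE andbC.
    by move=> x _; rewrite /g; case: (x \in K).
  by rewrite gE big_trivIset //=; apply: eq_bigr => X _; rewrite gE.
move: ltIJ; rewrite ltnNge => /negP; apply.
rewrite -(cardsID (cover P) J) -(cardsID (cover P) I).
apply: leq_add.
  rewrite !cardI; apply: leq_sum => X PX.
  by rewrite (Pc _ PX) iJ // PA.
apply/subset_leq_card/subsetP => x; rewrite !in_setD => /andP[ncx Jx].
rewrite ncx /=; apply: contraNT ncx => nIx.
by apply: (subsetP covJ); rewrite inE nIx.
Qed.

Definition laminar_matroid_of : matroid E :=
  Matroid laminar_indep0 laminar_indepS laminar_indep_aug.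

End LaminarMatroid.

Definition laminar_matroid (E : finType) (M : matroid E) : Prop :=
  exists (F : finType) (A : {set {set F}}) (c : {set F} -> nat)
         (lamA : laminar_family A),
    matroid_iso M (laminar_matroid_of c lamA).

(* Main.v *)
(** If B_1 <= ... <= B_n is a nested presentation, then E and the complements
    of the B_i form a chain, hence a laminar family; give a member the number of
    sets B_j meeting it as capacity. A partial transversal clearly satisfies
    these bounds. Conversely, list the elements of a set X satisfying them so
    that those lying in fewest of the B_j come first, and match the k-th element
    (k = 0, 1, ...) with B_(n-k): if it were not in B_(n-k), then neither would
    be the k elements before it, so k + 1 elements of X would lie in the
    complement of B_(n-k), which only meets the k sets above B_(n-k). *)
Require Import Defs.
From mathcomp Require Import all_boot.
Set Implicit Arguments.
Unset Strict Implicit.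
Unset Printing Implicit Defensive.

(** Each element of [X :&: A] is [e k] for some index [k], and this very element witnesses that the
    set indexed by [k] meets [A]; distinct elements use distinct indices. *)
Lemma partial_transversal_card_meet (E J : finType) (B : J -> {set E})
    (X A : {set E}) :
  is_partial_transversal B X ->
  #|X :&: A| <= #|[set j | B j :&: A != set0]|.
Proof.
case=> K [e [_ eB ->]].
have sub : [set e k | k : {j | j \in K}] :&: A \subset
    [set e k | k in [set k | e k \in A]].
  apply/subsetP => x /setIP[/imsetP[k _ ->] Ak].
  by apply: imset_f; rewrite inE.
apply: leq_trans (subset_leq_card sub) _.
apply: leq_trans (leq_imset_card _ _) _.
rewrite -(card_imset _ val_inj).
apply/subset_leq_card/subsetP => j /imsetP[k eAk ->].
move: eAk; rewrite !inE => Ak; apply/set0Pn.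
by exists (e k); rewrite inE eB.
Qed.

Lemma card_ord_lt_le (n m : nat) : #|[set j : 'I_n | j < m]| <= m.
Proof.
rewrite cardE -(size_map val) -{2}(size_iota 0 m).
apply: uniq_leq_size => [|x /mapP[j]].
  by rewrite (map_inj_uniq val_inj) enum_uniq.
by rewrite mem_enum inE mem_iota => lt_jm ->.
Qed.

Section NestedPresentation.

Variables (E : finType) (n : nat) (B : 'I_n -> {set E}).
Hypothesis B_mono : forall i j : 'I_n, i <= j -> B i \subset B j.

Definition nested_chain : {set {set E}} := setT |: [set ~: B i | i : 'I_n].

Definition nested_capacity (A : {set E}) : nat :=
  #|[set j | B j :&: A != set0]|.

Lemma nested_chain_laminar : laminar_family nested_chain.
Proof.
move=> X Y /setU1P[-> | /imsetP[i _ ->]]; first by right; apply: subsetT.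
case/setU1P=> [-> | /imsetP[j _ ->]] _; first by left; apply: subsetT.
rewrite !setCS.
by case/orP: (leq_total i j) => /B_mono; [right | left].
Qed.

(** By monotonicity only the [B j] with [i < j] can meet [~: B i]; [rev_ord] sends these indices to
    values below [rev_ord i], which is [n - 1 - i]. *)
Lemma nested_capacity_setC_le (i : 'I_n) :
  nested_capacity (~: B i) <= rev_ord i.
Proof.
apply: leq_trans (card_ord_lt_le n (rev_ord i)).
rewrite /nested_capacity -(card_imset _ (@rev_ord_inj n)).
apply/subset_leq_card/subsetP => _ /imsetP[j Aj ->].
move: Aj; rewrite !inE => /set0Pn[x /setIP[Bjx]]; rewrite inE => nBix.
rewrite /= ltn_sub2lE // ltnS ltnNge.
by apply: contra nBix => /B_mono/subsetP; apply.
Qed.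

Definition multiplicity (x : E) : nat := #|[set j | x \in B j]|.

(** The indices of the sets containing a given element form a final segment of ['I_n], so comparing
    their numbers amounts to comparing them by inclusion. *)
Lemma multiplicity_mem (x y : E) (i : 'I_n) :
  multiplicity x <= multiplicity y -> x \in B i -> y \in B i.
Proof.
move=> le_xy Bx; apply: contraLR le_xy => nBy; rewrite -ltnNge.
apply/proper_card/properP; split; last by exists i; rewrite inE.
apply/subsetP => j; rewrite !inE => Byj.
case: (leqP i j) => [/B_mono/subsetP | /ltnW/B_mono/subsetP sBji].
  by apply.
by rewrite sBji in nBy.
Qed.

Lemma nested_chain_bounds_transversal (X : {set E}) :
  (forall A, A \in nested_chain -> #|X :&: A| <= nested_capacity A) ->
  is_partial_transversal B X.
Proof.
move=> boundX.
have leXn : #|X| <= n.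
  (* This is the bound for the member [setT] of the chain, whose capacity is at most the number of
     indices. *)
  rewrite -[X]setIT (leq_trans (boundX _ (setU11 _ _))) //.
  by rewrite -[leqRHS](card_ord n) max_card.
pose le_mult := relpre multiplicity leq.
pose s := sort le_mult (enum X).
have size_s : size s == #|X| by rewrite size_sort cardE.
have uniq_s : uniq s by rewrite sort_uniq enum_uniq.
have mem_s x : (x \in s) = (x \in X) by rewrite mem_sort mem_enum.
have sorted_s : sorted le_mult s.
  by apply: sort_sorted => x y; apply: leq_total.
pose t := Tuple size_s.
have t_mono (i k : 'I_#|X|) : i <= k ->
    multiplicity (tnth t i) <= multiplicity (tnth t k).
  move=> le_ik; have x0 := tnth t i; rewrite !(tnth_nth x0) /=.
  apply: (sorted_leq_nth _ _ _ sorted_s) => //.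
  - by move=> y x z; apply: leq_trans.
  - by move=> x; apply: leqnn.
  - by rewrite inE (eqP size_s).
  - by rewrite inE (eqP size_s).
have t_inj : injective (tnth t) by apply/tuple_uniqP.
have tX i : tnth t i \in X by rewrite -mem_s mem_tnth.
have tB (j : 'I_n) (k : 'I_#|X|) : val k = rev_ord j -> tnth t k \in B j.
  move=> def_k; apply: contraT => nBk.
  have AB : ~: B j \in nested_chain by apply/setU1r/imset_f.
  have := leq_trans (boundX _ AB) (nested_capacity_setC_le j).
  rewrite leqNgt -def_k => /negP[].
  (* These [k + 1] positions all carry elements outside [B j], since their multiplicities do not
     exceed that of [tnth t k]; the bound for [~: B j] allows only [k]. *)
  pose below := [set i : 'I_#|X| | i <= k].
  have card_below : k < #|below|.
    have widen_inj : injective (widen_ord (ltn_ord k)).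
      by move=> i i' /(congr1 val)/= /val_inj.
    rewrite -[k.+1]card_ord -(card_codom widen_inj).
    apply/subset_leq_card/subsetP => _ /codomP[i ->].
    by rewrite inE /= -ltnS.
  apply: leq_trans card_below _; rewrite -(card_imset _ t_inj).
  apply/subset_leq_card/subsetP => _ /imsetP[i le_ik ->].
  rewrite !inE tX /=; apply: contra nBk.
  by apply/multiplicity_mem/t_mono; move: le_ik; rewrite inE.
(* The matched sets are the [#|X|] largest ones, so that [rev_ord] maps [K] onto the positions in
   [t]. *)
pose K := [set j : 'I_n | rev_ord j < #|X|].
have ltK (j : {j | j \in K}) : rev_ord (val j) < #|X|.
  by have := valP j; rewrite inE.
exists K, (fun j => tnth t (Ordinal (ltK j))); split.
- move=> j j' /t_inj/(congr1 val) /= eq_rev.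
  by apply/val_inj/rev_ord_inj/val_inj.
- by move=> j; apply: tB.
apply/setP => x; apply/idP/imsetP => [Xx | [j _ ->]]; last exact: tX.
have /tnthP[i def_x] : x \in t by rewrite mem_s.
pose j := rev_ord (widen_ord leXn i).
have Kj : j \in K by rewrite inE rev_ordK /=.
exists (Sub j Kj) => //; rewrite def_x; congr tnth.
exact/val_inj/esym/(congr1 val (rev_ordK (widen_ord leXn i))).
Qed.

End NestedPresentation.

Theorem mainTheorem5 (E : finType) (M : matroid E) :
  nested_matroid M -> laminar_matroid M.
Proof.
case=> n [B [presB monoB]].
exists E, (nested_chain B), (nested_capacity B), (nested_chain_laminar monoB).
exists id => [|I]; first by exists id.
rewrite imset_id; apply/idP/laminar_indepP => [/presB tI A _ | boundI].
  exact: partial_transversal_card_meet.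
exact/presB/(nested_chain_bounds_transversal monoB).
Qed.
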